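(* Let $G$ be a locally compact topological group with Haar measure $\mu$ that acts on $\mathcal X$, let $\pi$ be a $G$-invariant probability measure having a density with respect to a reference measure $\mathfrak m$ on $\mathcal X$, where $\frac{d\,\mathfrak m\circ g^{-1}}{d\mathfrak m}$ exists and equals $1$ for every $g\in G$. Let $P,M$ be Markov kernels on $\mathcal X$ admitting a transition density with respect to $\mathfrak m$ at every starting state $x$. Let $\nu$ be a probability measure on $G\times G$ and assume $M\in\mathcal D(G,\nu)$ and $P_{da}=P_{da}(G,\nu)\in\mathcal D(G,\nu)$. Then $$D^\pi_{KL}(P\|M)=D^\pi_{KL}(P\|P_{da})+D^\pi_{KL}(P_{da}\|M).$$ In particular, assuming $\pi$ is absolutely continuous with respect to the Lebesgue measure so that one may take $M=\Pi$, $$D^\pi_{KL}(P\|\Pi)\ge D^\pi_{KL}(P_{da}\|\Pi).$$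
   Context: $\mathcal X$ is a Polish space with its $\sigma$-algebra $\mathcal F$; $G$ acts measurably on it. A probability measure $\pi$ is $G$-invariant if $\pi(gA)=\pi(A)$ for all $g\in G,A\in\mathcal F$. $U_g[f](x)=f(gx)$, a Markov kernel $P$ acts by $P[f](x)=\int f(y)P(x,dy)$, and $P_{da}(G,\nu)=\mathbb E_{(g,h)\sim\nu}(U_gPU_h)$, i.e. $P_{da}(G,\nu)(x,A)=\int P(gx,h^{-1}A)\,\nu(dg\,dh)$. $\mathcal D(G,\nu)$ is the set of Markov kernels $K$ on $\mathcal X$ with $K_{da}(G,\nu)=K$. $\Pi$ is the kernel $\Pi(x,\cdot)=\pi$. The $\pi$-weighted KL divergence is $D_{KL}^\pi(P\|M)=\int\pi(dx)\int P(x,dy)\log\frac{dP(x,\cdot)}{dM(x,\cdot)}(y)$ if $P(x,\cdot)\ll M(x,\cdot)$ for $\pi$-a.e. $x$, and $+\infty$ otherwise. *)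

(* Defs.v *)
From HB Require Import structures.
From mathcomp Require Import all_boot all_order all_algebra.
From mathcomp Require Import all_classical all_reals all_analysis.
From mathcomp Require Import measurable_realfun.

Set Implicit Arguments.
Unset Strict Implicit.
Unset Printing Implicit Defensive.

Import Order.TTheory GRing.Theory Num.Theory.
Import numFieldNormedType.Exports.

Local Open Scope classical_set_scope.
Local Open Scope ring_scope.
Local Open Scope ereal_scope.

Notation borel T := (g_sigma_algebraType (@open T)).

Definition polish (R : realType) (T : topologicalType) : Prop :=
  exists dist : T -> T -> R,
  [/\ [/\ forall x y, (0 <= dist x y)%R,
          forall x y, dist x y = 0%R <-> x = y,
          forall x y, dist x y = dist y x &
          forall x y z, (dist x z <= dist x y + dist y z)%R],
      forall (x : T) (A : set T), nbhs x A <->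
        exists2 e : R, (0 < e)%R & [set y | (dist x y < e)%R] `<=` A,
      forall u : nat -> T,
        (forall e : R, (0 < e)%R -> exists N, forall i j,
           (N <= i)%N -> (N <= j)%N -> (dist (u i) (u j) < e)%R) ->
        exists l : T, u @ \oo --> l &
      exists D : set T, countable D /\ dense D].

HB.mixin Record isTopologicalGroup G of Topological G & Group G := {
  mulg_continuous : continuous (fun z : G * G => (z.1 * z.2)%g : G) ;
  invg_continuous : continuous (fun x : G => (x^-1)%g : G)
}.

(* Measurable types are pointed in the library, hence the (otherwise
   irrelevant) distinguished point *)
#[short(type="topologicalGroupType")]
HB.structure Definition TopologicalGroup :=
  {G of isTopologicalGroup G & Topological G & Group G & Pointed G}.

Definition locally_compact_group (G : topologicalGroupType) : Prop :=
  hausdorff_space G /\ locally_compact [set: G].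

(* Left Haar measure, Radon in the sense: finite on compact sets, outer regular
   on Borel sets, inner regular on open sets *)
Definition is_haar_measure (R : realType) (G : topologicalGroupType)
    (mu : {measure set (borel G) -> \bar R}) : Prop :=
  [/\ mu setT != 0,
      forall (g : G) (A : set (borel G)), measurable A ->
        mu ((fun h : G => (g * h)%g) @` A) = mu A,
      forall K : set G, compact K -> mu K < +oo,
      forall A : set (borel G), measurable A ->
        mu A = ereal_inf [set mu U | U in [set U : set G | open U /\ A `<=` U]]
    & forall U : set G, open U ->
        mu U = ereal_sup
          [set mu K | K in [set K : set G | compact K /\ K `<=` U]]].

(* Joint measurability makes [(g, h) |-> P (g x) (h^-1 A)] measurable *)
Record measurable_action (G : topologicalGroupType) d (X : measurableType d) :=
  MeasurableAction {
    act :> G -> X -> X ;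
    act1 : forall x, act 1%g x = x ;
    actM : forall g h x, act (g * h)%g x = act g (act h x) ;
    measurable_act :
      measurable_fun [set: borel G * X] (fun z : borel G * X => act z.1 z.2) }.

Section group_action.
Context (G : topologicalGroupType) d (X : measurableType d) (R : realType).
Variable a : measurable_action G X.

Definition invariant_measure (pi : set X -> \bar R) : Prop :=
  forall g A, measurable A -> pi (a g @` A) = pi A.

Lemma act_image (g : G) (A : set X) : a (g^-1)%g @` A = a g @^-1` A.
Proof.
apply/seteqP; split=> [_ [y Ay <-]|y Ay] /=.
  by rewrite -actM mulgV act1.
by exists (a g y) => //; rewrite -actM mulVg act1.
Qed.

Lemma measurable_actx (g : G) : measurable_fun [set: X] (a g).
Proof.
apply: (measurableT_comp (measurable_act a)
  (f := fun z : borel G * X => a z.1 z.2) (g := fun x => (g : borel G, x))).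
exact: pair1_measurable.
Qed.

End group_action.

Definition is_density d (X : measurableType d) (R : realType)
    (nu : set X -> \bar R) (m : {measure set X -> \bar R})
    (f : X -> \bar R) : Prop :=
  [/\ measurable_fun [set: X] f, forall x, 0 <= f x &
      forall A, measurable A -> nu A = \int[m]_(x in A) f x].

Definition has_density d (X : measurableType d) (R : realType)
    (nu : set X -> \bar R) (m : {measure set X -> \bar R}) : Prop :=
  exists f, is_density nu m f.

Section data_augmentation.
Context (G : topologicalGroupType) d (X : measurableType d) (R : realType).
Variables (a : measurable_action G X)
  (nu : probability (borel G * borel G)%type R) (P : R.-pker X ~> X).

(* [P_da(x, A) = E_nu P(g x, h^-1 A)], the kernel of [f |-> E_nu U_g P U_h f] *)
Definition da (x : X) (A : set X) : \bar R :=
  \int[nu]_gh P (a gh.1 x) (a (gh.2^-1)%g @` A).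

Let Z := (X * (borel G * borel G))%type.

Let shift (z : Z) : X := a z.2.1 z.1.

Let measurable_shift : measurable_fun [set: Z] shift.
Proof.
apply: (measurableT_comp (measurable_act a)
  (f := fun z : borel G * X => a z.1 z.2) (g := fun z : Z => (z.2.1, z.1))).
by apply/measurable_fun_pair => //=; exact: measurableT_comp.
Qed.

Definition kshift (z : Z) : {measure set X -> \bar R} := P (shift z).

Let measurable_kshift U : measurable U -> measurable_fun [set: Z] (kshift ^~ U).
Proof. by move=> mU; exact: measurableT_comp (measurable_kernel P _ mU) _. Qed.

HB.instance Definition _ := isKernel.Build _ _ Z X R kshift measurable_kshift.

Let kshift1 z : kshift z setT = 1. Proof. exact: prob_kernel. Qed.

HB.instance Definition _ := Kernel_isProbability.Build _ _ Z X R kshift kshift1.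

Lemma measurable_da_integrand (A : set X) : measurable A ->
  measurable_fun [set: X * (borel G * borel G)]
    (fun z : X * (borel G * borel G) => P (a z.2.1 z.1) (a (z.2.2^-1)%g @` A)).
Proof.
move=> mA.
pose move_ (w : Z * X) : X := a w.1.2.2 w.2.
have mmove : measurable_fun setT move_.
  apply: (measurableT_comp (measurable_act a)
    (f := fun z : borel G * X => a z.1 z.2)
    (g := fun w : Z * X => (w.1.2.2, w.2))).
  apply/measurable_fun_pair => //=.
  by apply: measurableT_comp => //; apply: measurableT_comp => //;
    exact: measurableT_comp.
pose k (w : Z * X) : \bar R := (\1_A (move_ w))%:E.
have mk : measurable_fun setT k.
  apply/measurable_EFinP.
  have mi : measurable_fun setT (\1_A : X -> R) by exact: measurable_indic.
  exact: measurableT_comp mi mmove.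
have k0 w : 0 <= k w by rewrite lee_fin.
have := measurable_fun_integral_finite_kernel k kshift k0 mk.
apply: eq_measurable_fun => z _.
rewrite act_image /k /move_ /=.
transitivity (\int[kshift z]_y (\1_(a z.2.2 @^-1` A) y)%:E).
  by apply: eq_integral.
rewrite integral_indic// ?setIT//.
rewrite -[X in measurable X]setTI.
exact: measurable_actx.
Qed.

Let measurable_da_integrandx x (A : set X) : measurable A ->
  measurable_fun [set: borel G * borel G]
    (fun gh => P (a gh.1 x) (a (gh.2^-1)%g @` A)).
Proof.
move=> mA.
apply: (measurableT_comp (measurable_da_integrand mA)
  (g := fun gh : borel G * borel G => (x, gh))).
exact: pair1_measurable.
Qed.

Let da0 x : da x set0 = 0.
Proof. by rewrite /da integral0_eq// => gh _; rewrite image_set0 measure0. Qed.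

Let da_ge0 x A : 0 <= da x A. Proof. exact: integral_ge0. Qed.

Let da_sigma_additive x : semi_sigma_additive (da x).
Proof.
move=> F mF tF mUF; rewrite [X in _ --> X](_ : _ =
  \int[nu]_gh (\sum_(n <oo) P (a gh.1 x) (a (gh.2^-1)%g @` F n))); last first.
  apply: eq_integral => gh _; apply/esym/cvg_lim => //.
  rewrite image_bigcup; apply: measure_semi_sigma_additive.
  - move=> n; rewrite act_image -[X in measurable X]setTI.
    exact: measurable_actx.
  - apply/trivIsetP => i j _ _ ij; rewrite !act_image -preimage_setI.
    by move/trivIsetP : tF => ->//; rewrite preimage_set0.
  - rewrite -image_bigcup act_image -[X in measurable X]setTI.
    exact: measurable_actx.
apply/cvg_closeP; split.
  by apply: is_cvg_nneseries => n _ _; exact: integral_ge0.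
rewrite closeE// integral_nneseries// => n.
exact: measurable_da_integrandx.
Qed.

HB.instance Definition _ x := isMeasure.Build _ _ R
  (da x) (da0 x) (da_ge0 x) (@da_sigma_additive x).

(* [da] repackaged so that it can carry the Markov kernel structure *)
Definition kda : X -> {measure set X -> \bar R} := da.

Let measurable_kda U : measurable U -> measurable_fun [set: X] (kda ^~ U).
Proof.
move=> mU.
apply: (measurable_fun_fubini_tonelli_F (m2 := nu) _
  (measurable_da_integrand mU)) => z; exact: measure_ge0.
Qed.

HB.instance Definition _ := isKernel.Build _ _ X X R kda measurable_kda.

Let kda1 x : kda x setT = 1.
Proof.
rewrite /kda /= /da.
under eq_integral do rewrite act_image preimage_setT prob_kernel.
by rewrite integral_cst// mul1e; exact: probability_setT.
Qed.

HB.instance Definition _ := Kernel_isProbability.Build _ _ X X R kda kda1.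

End data_augmentation.

(* The class D(G, nu); kernels are compared on measurable sets *)
Definition da_class (G : topologicalGroupType) d (X : measurableType d)
    (R : realType) (a : measurable_action G X)
    (nu : probability (borel G * borel G)%type R) : set (R.-pker X ~> X) :=
  [set K | forall x A, measurable A -> kda a nu K x A = K x A].

Section weighted_KL.
Context d (X : measurableType d) (R : realType).

Section probability_of_kernel.
Variables (P : R.-pker X ~> X) (x : X).

(* [P x] seen as an element of [probability X R] *)
Definition kprob : set X -> \bar R := P x.

HB.instance Definition _ := Measure.on kprob.

Let kprob_setT : kprob setT = 1. Proof. exact: prob_kernel. Qed.

HB.instance Definition _ := Measure_isProbability.Build _ _ _ kprob kprob_setT.

End probability_of_kernel.

(* [lne] is [-oo] where the density vanishes, a [P x]-null set; the
   integrand is irrelevant on the [pi]-null set where [P x << M x] fails. *)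
Definition KL (pi : probability X R) (P M : R.-pker X ~> X) : \bar R :=
  if `[< {ae pi, forall x, P x `<< M x} >] then
    \int[pi]_x \int[P x]_y
      lne (Radon_Nikodym (charge_of_finite_measure (kprob P x)) (kprob M x) y)
  else +oo.

(* The kernel [Pi(x, .) = pi] *)
Definition kconst (pi : probability X R) : X -> {measure set X -> \bar R} :=
  fun=> pi.

Variable pi : probability X R.

Let measurable_kconst U : measurable U -> measurable_fun [set: X] (kconst pi ^~ U).
Proof. by move=> _; exact: measurable_cst. Qed.

HB.instance Definition _ :=
  isKernel.Build _ _ X X R (kconst pi) measurable_kconst.

Let kconst1 x : kconst pi x setT = 1. Proof. exact: probability_setT. Qed.

HB.instance Definition _ :=
  Kernel_isProbability.Build _ _ X X R (kconst pi) kconst1.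

End weighted_KL.

(* Main.v *)
Require Import Defs.
From HB Require Import structures.
From mathcomp Require Import all_boot all_order all_algebra.
From mathcomp Require Import all_classical all_reals all_analysis.
From mathcomp Require Import measurable_realfun.
From mathcomp Require Import ring lra.

(** The weighted divergence of two kernels is the relative entropy of the joint
    laws that they form with pi on X * X ([KL_joint]), so the identity concerns
    three probability measures on a single space: kappa for P, lambda for its
    augmentation and mu for M.  Since pi is G-invariant, augmenting a kernel
    amounts to moving its joint law by the Markov kernel K that sends (x, y) to
    (g^-1 x, h y) with (g, h) drawn from nu ([twist_transports]).  The
    hypotheses then read mu K = mu, kappa K = lambda and lambda K = lambda, and
    the claim becomes a Pythagorean identity valid for every Markov kernel K
    ([relent_pythagoras]).

    Its heart is that f = d lambda / d mu is invariant under K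
    ([invariant_density]).  Let Z0 have law mu and let Z1 be drawn from
    K(Z0, .); Z1 has law mu as well.  As lambda K = lambda,
    f(Z1) = E[f(Z0) | Z1], so f(Z1), f(Z0) is a martingale whose two terms have
    the same law.  A strictly convex function cannot gain expectation along it,
    hence f(Z0) = f(Z1) almost surely.

    Let p = d kappa / d mu.  Likewise f(Z1) = E[p(Z0) | Z1], so for every
    psi >= 0
      int psi(f) d kappa = E[p(Z0) psi(f(Z0))] = E[p(Z0) psi(f(Z1))]
                         = int psi(f) d lambda
    ([integral_invariant_density]).  With psi the indicator of 0 this gives
    kappa << lambda.  With psi the positive and the negative part of the
    logarithm it gives int log f d kappa = int log f d lambda, the relative
    entropy of lambda with respect to mu; the identity follows from
    log (d kappa / d mu) = log (d kappa / d lambda) + log f.  When kappa << mu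
    fails, one of the two terms on the right is infinite too.

    Infinite values are handled by writing relative entropy as the integral of
    the nonnegative function t log t - t + 1 of the density
    ([relent_density]), and by moving the negative part of the logarithm, whose
    integral is at most 1, to the other side of each equation.

    The passage between kernels and joint laws needs a density of P x with
    respect to M x that is jointly measurable in both points: it is obtained
    from the Radon-Nikodym theorem on X * X, and it restricts to almost every
    fiber because the Borel sets of a Polish space are countably generated
    ([kernel_density]).

    The inequality is the case where M is the constant kernel pi, which belongs
    to the class because pi is invariant. *)

Set Implicit Arguments.
Unset Strict Implicit.
Unset Printing Implicit Defensive.

Import Order.TTheory GRing.Theory Num.Theory.

Local Open Scope classical_set_scope.
Local Open Scope ring_scope.
Local Open Scope ereal_scope.

(** * The entropy integrand *)

Section kl_integrand.
Context {R : realType}.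
Local Open Scope ring_scope.

(** The integrand of relative entropy, made nonnegative by adding [1 - t], whose
    integral vanishes when [t] is the density of a probability measure. *)
Definition klfun (t : R) : R := t * ln t - t + 1.
Definition lnpos (t : R) : R := Num.max (ln t) 0.
Definition lnneg (t : R) : R := Num.max (- ln t) 0.

Lemma lnposB t : lnpos t - lnneg t = ln t.
Proof. rewrite /lnpos /lnneg /Num.max; case: ifP; case: ifP; lra. Qed.

Lemma lnpos_ge0 t : 0 <= lnpos t.
Proof. by rewrite /lnpos le_max lexx orbT. Qed.

Lemma lnneg_ge0 t : 0 <= lnneg t.
Proof. by rewrite /lnneg le_max lexx orbT. Qed.

Lemma klfun_ge0 t : 0 <= t -> 0 <= klfun t.
Proof.
rewrite /klfun le_eqVlt => /predU1P[<-|t0]; first by rewrite mul0r; lra.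
have : ln (1 + (t^-1 - 1)) <= t^-1 - 1.
  by apply: le_ln1Dx; rewrite ltrBDr addrC subrr invr_gt0.
rewrite addrC subrK lnV// => h.
have : t * - ln t <= t * (t^-1 - 1) by rewrite ler_pM2l.
rewrite mulrBr mulfV ?gt_eqF//; lra.
Qed.

(** This bound makes the negative part of a log-likelihood integrable, so that
    only the positive part can be infinite. *)
Lemma lnneg_mul_le1 t : 0 <= t -> t * lnneg t <= 1.
Proof.
move=> t0; have := klfun_ge0 t0; rewrite /klfun /lnneg /Num.max.
by case: ifPn => _; rewrite ?mulr0 ?mulrN; lra.
Qed.

(** All the terms are nonnegative, so this form of [klfun t = t ln t - t + 1]
    can be integrated term by term even when some integrals are infinite. *)
Lemma klfun_split t : klfun t + t * lnneg t + t = t * lnpos t + 1.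
Proof. by rewrite /klfun -(lnposB t); ring. Qed.

(** The chain rule of densities, [ln (q f) = ln q + ln f], again arranged with
    nonnegative terms only. It survives the vanishing of [q] or [f] because
    each logarithm comes with its argument as a factor. *)
Lemma klfun_chain q f : 0 <= q -> 0 <= f ->
  klfun (q * f) + q * f * lnneg f + f = f * klfun q + q * f * lnpos f + 1.
Proof.
move=> q0 f0; have -> : lnpos f = ln f + lnneg f by rewrite -(lnposB f) subrK.
suff : q * f * ln (q * f) = q * f * ln q + q * f * ln f.
  by rewrite /klfun => ->; ring.
move: q0; rewrite le_eqVlt => /predU1P[<-|q0]; first by rewrite !mul0r; ring.
move: f0; rewrite le_eqVlt => /predU1P[<-|f0].
  by rewrite !mulr0 !mul0r; ring.
by rewrite lnM ?posrE// mulrDr.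
Qed.

Lemma measurable_klfun : measurable_fun [set: R] klfun.
Proof.
apply: measurable_funD => //; apply: measurable_funB => //.
exact: measurable_funM.
Qed.

Lemma measurable_lnpos : measurable_fun [set: R] lnpos.
Proof. exact: measurable_maxr. Qed.

Lemma measurable_lnneg : measurable_fun [set: R] lnneg.
Proof. by apply: measurable_maxr => //; exact: measurableT_comp. Qed.

End kl_integrand.

(** * Densities of finite measures *)

Section density.
Context d (T : measurableType d) (R : realType).

Import HBNNSimple.

(** Meant for the fiberwise divergence, which is only known to agree almost
    everywhere with a measurable function. *)
Lemma integral_eq_off_null (mu : {measure set T -> \bar R}) (N : set T)
    (f g : T -> \bar R) :
  measurable N -> mu N = 0 -> (forall x, ~ N x -> f x = g x) ->
  \int[mu]_x f x = \int[mu]_x g x.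
Proof.
move=> mN N0.
have le0 (u v : T -> \bar R) : (forall x, 0 <= u x) -> (forall x, 0 <= v x) ->
    (forall x, ~ N x -> u x = v x) -> \int[mu]_x u x <= \int[mu]_x v x.
  move=> u0 v0 uv; rewrite !ge0_integralTE//.
  apply: ge_ereal_sup => _ [h /= hu <-].
  pose h' := proj_nnsfun h (measurableC mN).
  have -> : sintegral mu h = sintegral mu h'.
    have sE (k : {nnsfun T >-> R}) : sintegral mu k = \int[mu]_x (k x)%:E.
      by rewrite integral_nnsfun// patch_setT.
    rewrite !sE; apply: ge0_ae_eq_integral => //.
    - exact/measurable_EFinP.
    - exact/measurable_EFinP.
    - by move=> x _; rewrite lee_fin.
    - by move=> x _; rewrite lee_fin.
    exists N; split=> // x /= hx; apply: contrapT => Nx; apply: hx => _.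
    by rewrite /= mindicE mem_set// mulr1.
  apply: ereal_sup_ubound; exists h' => //= x; rewrite mindicE.
  have [Nx|Nx] := pselect (N x).
    by rewrite memNset ?mulr0//= => /(_ Nx).
  by rewrite mem_set// mulr1 -uv.
have eq0 (u v : T -> \bar R) : (forall x, 0 <= u x) -> (forall x, 0 <= v x) ->
    (forall x, ~ N x -> u x = v x) -> \int[mu]_x u x = \int[mu]_x v x.
  move=> u0 v0 uv; apply/eqP; rewrite eq_le !le0// => x Nx.
  by rewrite uv.
move=> fg; rewrite integralE [RHS]integralE.
by congr (_ - _); apply: eq0 => // x Nx; rewrite ?funeposE ?funenegE fg.
Qed.

Lemma exists_density (kappa mu : {finite_measure set T -> \bar R}) :
  kappa `<< mu -> exists p : T -> R, is_density kappa mu (EFin \o p).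
Proof.
move=> kmu.
have [f [f0 ffin fint fE]] := @radon_nikodym_sigma_finite _ _ _ mu kappa kmu.
exists (fine \o f).
have fineE : EFin \o (fine \o f) = f by apply/funext => x /=; rewrite fineK.
by split; rewrite fineE//; exact: measurable_int fint.
Qed.

Lemma density_dominates (kappa mu : {measure set T -> \bar R}) f :
  is_density kappa mu f -> kappa `<< mu.
Proof.
move=> [mf f0 fE]; apply/null_content_dominatesP => A mA A0.
rewrite fE// null_set_integral//; exact: measurable_funTS.
Qed.

Lemma density_unique (kappa : {finite_measure set T -> \bar R})
    (mu : {measure set T -> \bar R}) f g :
  is_density kappa mu f -> measurable_fun [set: T] g ->
  (forall A, measurable A -> kappa A = \int[mu]_(x in A) g x) ->
  ae_eq mu setT f g.
Proof.
move=> [mf f0 fE] mg gE; apply: integral_ae_eq => //.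
  apply/integrableP; split=> //.
  under eq_integral do rewrite gee0_abs//.
  by rewrite -fE// ltey_eq fin_num_measure.
by move=> A _ mA; rewrite -fE// gE.
Qed.

Lemma integral_density (kappa mu : {finite_measure set T -> \bar R}) f h :
  is_density kappa mu f -> (forall x, 0 <= h x) -> measurable_fun [set: T] h ->
  \int[kappa]_x h x = \int[mu]_x (h x * f x).
Proof.
move=> fE h0 mh; have kmu := density_dominates fE.
rewrite -(Radon_Nikodym_SigmaFinite.change_of_variables kmu h0)//.
have mrn : measurable_fun [set: T] (Radon_Nikodym_SigmaFinite.f kappa mu).
  exact: measurable_int (Radon_Nikodym_SigmaFinite.f_integrable kmu).
have rnE := density_unique fE mrn (Radon_Nikodym_SigmaFinite.f_integral kmu).
case: fE => mf f0 _; apply: ae_eq_integral => //.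
- exact: emeasurable_funM.
- exact: emeasurable_funM.
by apply: filterS rnE => x /= /[apply] ->.
Qed.

End density.

(** * Relative entropy *)

Section relative_entropy.
Context d (T : measurableType d) (R : realType).
Implicit Types kappa lambda mu : probability T R.

Definition relent kappa mu : \bar R :=
  if `[< kappa `<< mu >] then
    \int[kappa]_x lne (Radon_Nikodym (charge_of_finite_measure kappa) mu x)
  else +oo.

Lemma density_ge0 kappa mu (p : T -> R) :
  is_density kappa mu (EFin \o p) -> forall x, (0 <= p x)%R.
Proof. by move=> [_ p0 _] x; have := p0 x; rewrite lee_fin. Qed.

Lemma measurable_density kappa mu (p : T -> R) :
  is_density kappa mu (EFin \o p) -> measurable_fun [set: T] p.
Proof. by move=> [mp _ _]; exact/measurable_EFinP. Qed.

Lemma density_null kappa mu (p : T -> R) :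
  is_density kappa mu (EFin \o p) -> kappa (p @^-1` [set 0%R]) = 0.
Proof.
move=> pE; have mp := measurable_density pE.
case: pE => _ _ ->; last by rewrite -[X in measurable X]setTI; exact: mp.
by apply: integral0_eq => x /= ->.
Qed.

Lemma density_total kappa mu f : is_density kappa mu f -> \int[mu]_x f x = 1.
Proof. by move=> [_ _ <-//]; exact: probability_setT. Qed.

Lemma integral_lnneg_le1 kappa mu (p : T -> R) :
  is_density kappa mu (EFin \o p) -> \int[kappa]_x (lnneg (p x))%:E <= 1.
Proof.
move=> pE; have mp := measurable_density pE.
have mln : measurable_fun setT (fun x => (lnneg (p x))%:E).
  apply/measurable_EFinP; apply: measurableT_comp mp; exact: measurable_lnneg.
rewrite (integral_density pE)//; last by move=> x; rewrite lee_fin lnneg_ge0.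
apply: (@le_trans _ _ (\int[mu]_x (cst 1 x))); last first.
  by rewrite integral_cst// mul1e probability_le1.
apply: ge0_le_integral => //.
- by move=> x _; rewrite -EFinM lee_fin mulr_ge0 ?lnneg_ge0 ?(density_ge0 pE).
- by apply: emeasurable_funM => //; exact/measurable_EFinP.
- by move=> x _; rewrite -EFinM lee_fin mulrC lnneg_mul_le1 ?(density_ge0 pE).
Qed.

Lemma klfun_integral kappa mu (p : T -> R) :
  is_density kappa mu (EFin \o p) ->
  \int[mu]_x (klfun (p x))%:E + \int[kappa]_x (lnneg (p x))%:E =
  \int[kappa]_x (lnpos (p x))%:E.
Proof.
move=> pE; have p0 := density_ge0 pE; have mp := measurable_density pE.
have mEp : measurable_fun setT (EFin \o p) by exact/measurable_EFinP.
have mln : measurable_fun setT (fun x => (lnneg (p x))%:E).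
  apply/measurable_EFinP; apply: measurableT_comp mp; exact: measurable_lnneg.
have mlp : measurable_fun setT (fun x => (lnpos (p x))%:E).
  apply/measurable_EFinP; apply: measurableT_comp mp; exact: measurable_lnpos.
have mk : measurable_fun setT (fun x => (klfun (p x))%:E).
  apply/measurable_EFinP; apply: measurableT_comp mp; exact: measurable_klfun.
have ln0 x : 0 <= (lnneg (p x))%:E by rewrite lee_fin lnneg_ge0.
have lp0 x : 0 <= (lnpos (p x))%:E by rewrite lee_fin lnpos_ge0.
have k0 x : 0 <= (klfun (p x))%:E by rewrite lee_fin klfun_ge0.
have Ep0 x : 0 <= (p x)%:E by rewrite lee_fin.
rewrite !(integral_density pE)//=.
(* The number added to both sides is the integral of a density on the left and
   of the constant [1] on the right, as the pointwise identity requires. *)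
rewrite -[LHS](@addeK _ 1)// -[RHS](@addeK _ 1)//; congr (_ - _).
rewrite -[X in _ + X = _](density_total pE).
rewrite -[X in _ = _ + X](@probability_setT _ _ _ mu).
rewrite -[X in _ = _ + X]mul1e -integral_cst//.
have m1 : measurable_fun setT (fun x => (lnneg (p x))%:E * (p x)%:E).
  exact: emeasurable_funM.
have m2 : measurable_fun setT (fun x => (lnpos (p x))%:E * (p x)%:E).
  exact: emeasurable_funM.
have n1 x : 0 <= (lnneg (p x))%:E * (p x)%:E by rewrite mule_ge0.
have n2 x : 0 <= (lnpos (p x))%:E * (p x)%:E by rewrite mule_ge0.
rewrite -!ge0_integralD//; try exact: emeasurable_funD.
all: try by move=> x _ /=; rewrite ?adde_ge0.
apply: eq_integral => x _ /=.
by rewrite -!EFinM -!EFinD ![(_ * p x)%R]mulrC klfun_split.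
Qed.

(** A density may replace the Radon-Nikodym derivative, and the integral of a
    signed logarithm becomes that of a nonnegative function. The two agree
    outside a [kappa]-null set that contains the zeros of [p], where [lne]
    takes the value [-oo]. *)
Lemma relent_density kappa mu (p : T -> R) :
  is_density kappa mu (EFin \o p) ->
  relent kappa mu = \int[mu]_x (klfun (p x))%:E.
Proof.
move=> pE; have kmu := density_dominates pE; have p0 := density_ge0 pE.
have mp := measurable_density pE.
rewrite /relent asboolT//; set q := Radon_Nikodym _ _.
have mq : measurable_fun setT q.
  exact: measurable_int (Radon_Nikodym_integrable _).
have [N [mN N0 pqN]] : ae_eq mu setT (EFin \o p) q.
  apply: (density_unique pE mq) => A mA.
  by rewrite -Radon_Nikodym_integral.
have mZ : measurable (p @^-1` [set 0%R]).
  by rewrite -[X in measurable X]setTI; exact: mp.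
rewrite (@integral_eq_off_null _ _ _ kappa (N `|` p @^-1` [set 0%R]) _
  (EFin \o (fun x => ln (p x))))//; last 3 first.
- exact: measurableU.
- rewrite measureU0//; last exact: density_null pE.
  by move/null_content_dominatesP : kmu; exact.
- move=> x /not_orP[Nx /= px0].
  have <- : (p x)%:E = q x by apply: contrapT => h; apply/Nx/pqN => /= /(_ I).
  by rewrite lne_EFin// lt0r p0 andbT; exact/eqP.
rewrite integralE funerpos funerneg.
rewrite -[X in X - _](klfun_integral pE) addeK// ge0_fin_numE.
  by rewrite (le_lt_trans (integral_lnneg_le1 pE)) ?ltry.
by apply: integral_ge0 => x _; rewrite lee_fin lnneg_ge0.
Qed.

Lemma relent_not_dominated kappa mu : ~ kappa `<< mu -> relent kappa mu = +oo.
Proof. by move=> h; rewrite /relent asboolF. Qed.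

Lemma relent_ge0 kappa mu : 0 <= relent kappa mu.
Proof.
have [kmu|?] := pselect (kappa `<< mu); last by rewrite relent_not_dominated.
have [p pE] := exists_density kmu.
rewrite (relent_density pE); apply: integral_ge0 => x _.
by rewrite lee_fin klfun_ge0// (density_ge0 pE).
Qed.

(** Subtracting the two logarithmic terms would give
    [relent kappa mu = relent kappa lambda + \int[kappa] ln f], which is
    meaningless when they are both infinite. *)
Lemma relent_chain kappa lambda mu (q f : T -> R) :
  is_density kappa lambda (EFin \o q) -> is_density lambda mu (EFin \o f) ->
  relent kappa mu + \int[kappa]_x (lnneg (f x))%:E =
  relent kappa lambda + \int[kappa]_x (lnpos (f x))%:E.
Proof.
move=> qE fE.
have q0 := density_ge0 qE; have mq := measurable_density qE.
have f0 := density_ge0 fE; have mf := measurable_density fE.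
have qfE : is_density kappa mu (EFin \o (fun x => q x * f x)%R).
  split.
  - by apply/measurable_EFinP; exact: measurable_funM.
  - by move=> x; rewrite lee_fin mulr_ge0.
  move=> A mA; case: (qE) => mEq Eq0 ->//.
  rewrite integral_mkcond (integral_density fE); last 2 first.
  - by move=> x; exact: erestrict_ge0.
  - exact/(measurable_restrictT _ _).1/measurable_funTS.
  rewrite [RHS]integral_mkcond; apply: eq_integral => x _ /=.
  by rewrite !patchE; case: ifP => _; rewrite ?mul0e.
rewrite (relent_density qE) (relent_density qfE).
have mEf : measurable_fun setT (EFin \o f) by exact/measurable_EFinP.
have mEqf : measurable_fun setT (EFin \o (fun x => q x * f x)%R) by case: qfE.
have mln : measurable_fun setT (fun x => (lnneg (f x))%:E).
  apply/measurable_EFinP; apply: measurableT_comp mf; exact: measurable_lnneg.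
have mlp : measurable_fun setT (fun x => (lnpos (f x))%:E).
  apply/measurable_EFinP; apply: measurableT_comp mf; exact: measurable_lnpos.
have mk : measurable_fun setT (fun x => (klfun (q x))%:E).
  apply/measurable_EFinP; apply: measurableT_comp mq; exact: measurable_klfun.
have mk' : measurable_fun setT (fun x => (klfun (q x * f x))%:E).
  apply/measurable_EFinP; apply: (measurableT_comp measurable_klfun).
  exact: measurable_funM.
have ln0 x : 0 <= (lnneg (f x))%:E by rewrite lee_fin lnneg_ge0.
have lp0 x : 0 <= (lnpos (f x))%:E by rewrite lee_fin lnpos_ge0.
have k0 x : 0 <= (klfun (q x))%:E by rewrite lee_fin klfun_ge0.
have k'0 x : 0 <= (klfun (q x * f x))%:E by rewrite lee_fin klfun_ge0 ?mulr_ge0.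
have Ef0 x : 0 <= (f x)%:E by rewrite lee_fin.
have Eqf0 x : 0 <= ((q x * f x)%R)%:E by rewrite lee_fin mulr_ge0.
rewrite !(integral_density qfE)// (integral_density fE)//=.
(* The number added to both sides is the integral of a density on the left and
   of the constant [1] on the right, as the pointwise identity requires. *)
rewrite -[LHS](@addeK _ 1)// -[RHS](@addeK _ 1)//; congr (_ - _).
rewrite -[X in _ + X = _](density_total fE).
rewrite -[X in _ = _ + X](@probability_setT _ _ _ mu).
rewrite -[X in _ = _ + X]mul1e -integral_cst//.
have m1 : measurable_fun setT (fun x => (lnneg (f x))%:E * (q x * f x)%:E).
  exact: emeasurable_funM.
have m2 : measurable_fun setT (fun x => (lnpos (f x))%:E * (q x * f x)%:E).
  exact: emeasurable_funM.
have m3 : measurable_fun setT (fun x => (klfun (q x))%:E * (f x)%:E).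
  exact: emeasurable_funM.
have n1 x : 0 <= (lnneg (f x))%:E * (q x * f x)%:E by rewrite mule_ge0.
have n2 x : 0 <= (lnpos (f x))%:E * (q x * f x)%:E by rewrite mule_ge0.
have n3 x : 0 <= (klfun (q x))%:E * (f x)%:E by rewrite mule_ge0.
rewrite -!ge0_integralD//; try exact: emeasurable_funD.
all: try by move=> x _ /=; rewrite ?adde_ge0.
apply: eq_integral => x _ /=.
rewrite -!EFinM -!EFinD; congr EFin.
have := klfun_chain (q0 x) (f0 x).
rewrite [(lnneg _ * _)%R]mulrC => ->; ring.
Qed.

End relative_entropy.

(** * The joint law of a probability measure and a Markov kernel *)

Section joint_distribution.
Context d1 d2 (T1 : measurableType d1) (T2 : measurableType d2) (R : realType).
Variables (mu : probability T1 R) (K : R.-pker T1 ~> T2).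

Let drop_parameter (w : (T1 * T1) * T2) : T1 * T2 := (w.1.2, w.2).

Let measurable_drop_parameter : measurable_fun setT drop_parameter.
Proof. by apply/measurable_fun_pair => //=; exact: measurableT_comp. Qed.

(** [jointE] gives the usual formula. As a composition of kernels, over a dummy
    parameter in [T1], the joint law inherits sigma-additivity and its integral
    formula from kernel composition. *)
Definition joint : set (T1 * T2) -> \bar R :=
  kcomp (kconst mu)
    (mkcomp (kernel.kernel_snd K) (kdirac measurable_drop_parameter)) point.

HB.instance Definition _ := Measure.on joint.

Lemma integral_joint (h : T1 * T2 -> \bar R) :
  (forall z, 0 <= h z) -> measurable_fun setT h ->
  \int[joint]_z h z = \int[mu]_x \int[K x]_y h (x, y).
Proof.
move=> h0 mh; rewrite integral_kcomp//; apply: eq_integral => x _.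
rewrite [LHS]integral_kcomp//; apply: eq_integral => y _.
by rewrite [LHS]integral_dirac// diracT mul1e.
Qed.

Let joint_setT : joint setT = 1.
Proof.
rewrite -[LHS]mul1e -integral_cst// integral_joint//.
under eq_integral do rewrite integral_cst// prob_kernel mule1.
by rewrite integral_cst// mul1e; exact: probability_setT.
Qed.

HB.instance Definition _ := Measure_isProbability.Build _ _ _ joint joint_setT.

Lemma jointE A : measurable A -> joint A = \int[mu]_x K x (xsection A x).
Proof.
move=> mA; rewrite -[LHS]mul1e -integral_cst//.
rewrite integral_mkcond/= integral_joint//; last 2 first.
- by move=> z; exact: erestrict_ge0.
- exact/(measurable_restrictT _ _).1.
apply: eq_integral => x _.
rewrite -[RHS]mul1e -integral_cst//; last exact: measurable_xsection.
rewrite [RHS]integral_mkcond; apply: eq_integral => y _.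
by rewrite !patchE mem_xsection.
Qed.

End joint_distribution.

(** * Densities of measures preserved by a Markov kernel *)

Section markov_density.
Context d (Z : measurableType d) (R : realType) (K : R.-pker Z ~> Z).
Implicit Types kappa lambda mu : probability Z R.

(** The equation [kappa K = lambda] between measures. *)
Definition transports kappa lambda :=
  forall A, measurable A -> \int[kappa]_z K z A = lambda A.

Lemma integral_transports kappa lambda (g : Z -> \bar R) :
  transports kappa lambda -> (forall z, 0 <= g z) -> measurable_fun setT g ->
  \int[kappa]_z \int[K z]_w g w = \int[lambda]_w g w.
Proof.
move=> kl g0 mg; transitivity (\int[joint kappa K]_z g z.2).
  by rewrite integral_joint//; exact: measurableT_comp.
transitivity (\int[pushforward (joint kappa K) snd]_z g z).
  by rewrite ge0_integral_pushforward.
apply: eq_measure_integral => A mA _.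
have m2 : measurable ((@snd Z Z) @^-1` A).
  by rewrite -[X in measurable X]setTI; exact: measurable_snd.
transitivity (\int[kappa]_z K z A); last exact: kl.
rewrite [LHS]jointE//; apply: eq_integral => z _.
by congr (K z _); rewrite xsectionE.
Qed.

(** If (Z0, Z1) has law [joint mu K], this says that the density of [lambda] at
    Z1 is the conditional expectation of p(Z0) given Z1. *)
Lemma integral_joint_density kappa lambda mu (p : Z -> R) (g : Z -> \bar R) :
  is_density kappa mu (EFin \o p) -> transports kappa lambda ->
  (forall z, 0 <= g z) -> measurable_fun setT g ->
  \int[joint mu K]_z ((p z.1)%:E * g z.2) = \int[lambda]_w g w.
Proof.
move=> pE kl g0 mg; rewrite -(integral_transports kl)//.
have p0 x : 0 <= (p x)%:E by rewrite lee_fin (density_ge0 pE).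
have mp : measurable_fun setT (EFin \o p) by case: pE.
rewrite (integral_density pE)//; last 2 first.
- by move=> z; exact: integral_ge0.
- by apply: measurable_fun_integral_kernel => // U mU; exact: measurable_kernel.
rewrite integral_joint//; last 2 first.
- by move=> z; rewrite mule_ge0.
- apply: emeasurable_funM; last exact: measurableT_comp.
  exact: (measurableT_comp mp measurable_fst).
by apply: eq_integral => z _ /=; rewrite ge0_integralZl//= muleC.
Qed.

Lemma integral_expRN_le1 kappa (f : Z -> R) :
  measurable_fun setT f -> (forall z, (0 <= f z)%R) ->
  \int[kappa]_z (expR (- f z))%:E <= 1.
Proof.
move=> mf f0; apply: (@le_trans _ _ (\int[kappa]_z (cst 1 z))); last first.
  by rewrite integral_cst// mul1e probability_le1.
apply: ge0_le_integral => //.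
- apply/measurable_EFinP; apply: (measurableT_comp (@measurable_expR R)).
  exact: measurableT_comp.
- by move=> z _; rewrite lee_fin -expR0 ler_expR oppr_le0.
Qed.

(** With Z0 and Z1 as above, f(Z1) = E[f(Z0) | Z1] while f(Z0) and f(Z1) have
    the same law. Test this against the strictly convex function expR (- t): the
    gap [D] between expR (- f(Z0)) and its tangent at f(Z1) is nonnegative and
    has expectation zero. Both expR (- t) and its derivative are bounded on
    nonnegative arguments, so every expectation is finite. *)
Lemma invariant_density lambda mu (f : Z -> R) :
  transports mu mu -> transports lambda lambda ->
  is_density lambda mu (EFin \o f) ->
  ae_eq (joint mu K) setT (f \o fst) (f \o snd).
Proof.
move=> mumu ll fE; have f0 := density_ge0 fE; have mf := measurable_density fE.
pose e z : R := expR (- f z).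
have e0 z : 0 <= (e z)%:E by rewrite lee_fin expR_ge0.
have me : measurable_fun setT e.
  by apply: (measurableT_comp (@measurable_expR R)); exact: measurableT_comp.
pose D (z : Z * Z) : R := (e z.1 - e z.2 + (f z.1 - f z.2) * e z.2)%R.
have DE z : D z = (e z.2 * (expR (f z.2 - f z.1) - (1 + (f z.2 - f z.1))))%R.
  rewrite /D mulrBr /e -expRD.
  have -> : (- f z.2 + (f z.2 - f z.1) = - f z.1)%R by ring.
  by ring.
have D0 z : (0 <= D z)%R.
  by rewrite DE mulr_ge0 ?expR_ge0// subr_ge0 expR_ge1Dx.
have mf1 : measurable_fun setT (fun z : Z * Z => f z.1).
  exact: measurableT_comp.
have mf2 : measurable_fun setT (fun z : Z * Z => f z.2).
  exact: measurableT_comp.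
have me1 : measurable_fun setT (fun z : Z * Z => e z.1).
  exact: measurableT_comp.
have me2 : measurable_fun setT (fun z : Z * Z => e z.2).
  exact: measurableT_comp.
have mD : measurable_fun setT D.
  apply: measurable_funD; first exact: measurable_funB.
  by apply: measurable_funM => //; exact: measurable_funB.
set rho := joint mu K.
have I1 : \int[rho]_z (e z.1)%:E = \int[mu]_z (e z)%:E.
  rewrite integral_joint//; last exact/measurable_EFinP.
  apply: eq_integral => z _ /=.
  by rewrite integral_cst// prob_kernel mule1.
have mEe : measurable_fun setT (EFin \o e) by exact/measurable_EFinP.
have mEf : measurable_fun setT (EFin \o f) by exact/measurable_EFinP.
have I2 : \int[rho]_z (e z.2)%:E = \int[mu]_z (e z)%:E.
  rewrite integral_joint//; last exact/measurable_EFinP.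
  exact: (integral_transports mumu e0 mEe).
have I3 : \int[rho]_z ((f z.1)%:E * (e z.2)%:E) = \int[lambda]_z (e z)%:E.
  exact: (integral_joint_density fE ll e0 mEe).
have I4 : \int[rho]_z ((f z.2)%:E * (e z.2)%:E) = \int[lambda]_z (e z)%:E.
  rewrite (integral_density fE)// integral_joint//; last 2 first.
  - by move=> z; rewrite mule_ge0// lee_fin.
  - by apply: emeasurable_funM; exact/measurable_EFinP.
  under [RHS]eq_integral do rewrite muleC.
  apply: (integral_transports mumu (g := fun z => (f z)%:E * (e z)%:E)) => //.
  - by move=> z; rewrite mule_ge0// lee_fin.
  - exact: emeasurable_funM.
have intD0 : \int[rho]_z (D z)%:E = 0.
  set c : \bar R := \int[mu]_z (e z)%:E in I1 I2.
  set b : \bar R := \int[lambda]_z (e z)%:E in I3 I4.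
  have cb : c + b \is a fin_num.
    have c0 : 0 <= c by exact: integral_ge0.
    have b0 : 0 <= b by exact: integral_ge0.
    have c1 : c <= 1 := integral_expRN_le1 mu mf f0.
    have b1 : b <= 1 := integral_expRN_le1 lambda mf f0.
    rewrite ge0_fin_numE; last exact: adde_ge0.
    by rewrite (le_lt_trans (leeD c1 b1))// -EFinD ltry.
  suff DcE : \int[rho]_z (D z)%:E + (c + b) = c + b.
    by rewrite -[LHS](addeK _ cb) DcE subee.
  have m4 : measurable_fun setT (fun z : Z * Z => (f z.2)%:E * (e z.2)%:E).
    by apply: emeasurable_funM; exact/measurable_EFinP.
  have m3 : measurable_fun setT (fun z : Z * Z => (f z.1)%:E * (e z.2)%:E).
    by apply: emeasurable_funM; exact/measurable_EFinP.
  have n4 (z : Z * Z) : 0 <= (f z.2)%:E * (e z.2)%:E.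
    by rewrite mule_ge0// lee_fin.
  have n3 (z : Z * Z) : 0 <= (f z.1)%:E * (e z.2)%:E.
    by rewrite mule_ge0// lee_fin.
  rewrite -{1}I2 -{1}I4 -{1}I1 -{1}I3 -!ge0_integralD//.
  all: try by apply/measurable_EFinP.
  all: try by apply: emeasurable_funD => //; apply/measurable_EFinP.
  all: try by move=> z _; rewrite ?lee_fin.
  all: try by move=> z _; exact: adde_ge0 (e0 _) (n4 _).
    apply: eq_integral => z _; rewrite -!EFinM -!EFinD; congr EFin.
  by rewrite /D; ring.
have [N [mN N0 DN]] : ae_eq rho setT (EFin \o D) (cst 0).
  apply/ae_eq_integral_abs => //; first exact/measurable_EFinP.
  rewrite -[RHS]intD0; apply: eq_integral => z _.
  by rewrite gee0_abs//= lee_fin.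
exists N; split => // z /= h; apply: DN => /= /(_ I)[] Dz0; apply: h => _.
apply/eqP; rewrite eq_sym -subr_eq0; apply: contraT => h.
have := expR_gt1Dx h; rewrite -subr_gt0 => h'.
move: Dz0; rewrite DE => /eqP; rewrite mulf_eq0 gt_eqF ?expR_gt0//=.
by rewrite gt_eqF.
Qed.

(** The law of [f] is the same under [kappa] and [lambda]: with Z0 and Z1 as
    above, kappa weighs events on Z0 by p(Z0), and f(Z0) may be replaced by
    f(Z1) before p(Z0) is averaged given Z1. *)
Lemma integral_invariant_density kappa lambda mu (p f : Z -> R)
    (psi : R -> \bar R) :
  transports mu mu -> transports kappa lambda ->
  transports lambda lambda ->
  is_density kappa mu (EFin \o p) -> is_density lambda mu (EFin \o f) ->
  (forall t, 0 <= psi t) -> measurable_fun setT psi ->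
  \int[kappa]_z psi (f z) = \int[lambda]_z psi (f z).
Proof.
move=> mumu kl ll pE fE psi0 mpsi; have mf := measurable_density fE.
have p0 x : 0 <= (p x)%:E by rewrite lee_fin (density_ge0 pE).
have mp : measurable_fun setT (EFin \o p) by case: pE.
have mpsif : measurable_fun setT (psi \o f) by exact: measurableT_comp.
rewrite -(integral_joint_density pE kl (g := psi \o f))//; last by move=> z /=.
have mp1 : measurable_fun setT (fun z : Z * Z => (p z.1)%:E).
  exact: (measurableT_comp mp measurable_fst).
transitivity (\int[joint mu K]_z ((p z.1)%:E * psi (f z.1))).
  rewrite (integral_density pE)// integral_joint//; last 2 first.
  - by move=> z; rewrite mule_ge0.
  - apply: emeasurable_funM => //.
    exact: (measurableT_comp mpsif measurable_fst).
  apply: eq_integral => z _.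
  by rewrite /= integral_cst// prob_kernel mule1 muleC.
apply: ae_eq_integral => //.
- apply: emeasurable_funM => //.
  exact: (measurableT_comp mpsif measurable_fst).
- apply: emeasurable_funM => //.
  exact: (measurableT_comp mpsif measurable_snd).
by apply: filterS (invariant_density mumu ll fE) => z /= /[apply] ->.
Qed.

Lemma transports_dominates kappa lambda mu :
  transports mu mu -> transports kappa lambda -> kappa `<< mu ->
  lambda `<< mu.
Proof.
move=> mumu kl kmu; apply/null_content_dominatesP => A mA A0.
rewrite -kl//.
have /(null_dominates_ae_eq measurableT kmu) K0 :
    ae_eq mu setT (K ^~ A) (cst 0).
  apply/ae_eq_integral_abs => //; first exact: measurable_kernel.
  transitivity (\int[mu]_z K z A); last exact: etrans (mumu _ mA) A0.
  apply: eq_integral => z _.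
  by rewrite gee0_abs.
rewrite (ae_eq_integral (cst 0))//; last exact: measurable_kernel.
by rewrite integral0.
Qed.

(** Where [f] vanishes, [lambda] has no mass, hence neither has [kappa] since
    the law of [f] is the same under both; elsewhere [lambda] and [mu] have the
    same null sets. *)
Lemma dominates_transports kappa lambda mu :
  transports mu mu -> transports kappa lambda ->
  transports lambda lambda ->
  kappa `<< mu -> kappa `<< lambda.
Proof.
move=> mumu kl ll kmu; have lmu := transports_dominates mumu kl kmu.
have [p pE] := exists_density kmu; have [f fE] := exists_density lmu.
have f0 := density_ge0 fE; have mf := measurable_density fE.
have m0 : measurable (f @^-1` [set 0%R]).
  by rewrite -[X in measurable X]setTI; exact: mf.
have kf0 : kappa (f @^-1` [set 0%R]) = 0.
  have : \int[kappa]_z (\1_(f @^-1` [set 0%R]) z)%:E =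
         \int[lambda]_z (\1_(f @^-1` [set 0%R]) z)%:E :> \bar R.
    apply: (@integral_invariant_density _ _ _ _ _ (EFin \o \1_[set 0%R])
      mumu kl ll pE fE).
    - by move=> t; rewrite lee_fin.
    - by apply/measurable_EFinP; exact: measurable_indic.
  by rewrite !integral_indic// !setIT => ->; exact: density_null fE.
apply/null_content_dominatesP => A mA A0.
have [N [mN N0 fN]] : ae_eq mu A (EFin \o f) (cst 0).
  apply/ae_eq_integral_abs => //.
    by apply: measurable_funTS; case: fE.
  transitivity (\int[mu]_(z in A) (f z)%:E).
    by apply: eq_integral => z _; rewrite gee0_abs//= lee_fin.
  by case: fE => _ _ <-.
apply: measure_negligible => //.
apply: (@negligibleS _ _ _ _ (N `|` f @^-1` [set 0%R])).
  move=> z Az; have [fz0|fz0] := pselect (f z = 0%R); first by right.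
  by left; apply: fN => /= /(_ Az)[].
apply: negligibleU.
  exists N; split => //.
  by move/null_content_dominatesP : kmu; exact.
by exists (f @^-1` [set 0%R]); split.
Qed.

(** In the chain rule of relative entropy for [kappa], [lambda] and [mu], the
    logarithm of [f] may be integrated against [lambda] in place of [kappa], and
    it then contributes [relent lambda mu]. *)
Theorem relent_pythagoras kappa lambda mu :
  transports mu mu -> transports kappa lambda ->
  transports lambda lambda ->
  relent kappa mu = relent kappa lambda + relent lambda mu.
Proof.
move=> mumu kl ll; have [kmu|nkmu] := pselect (kappa `<< mu); last first.
  rewrite (relent_not_dominated nkmu).
  have [kla|nkla] := pselect (kappa `<< lambda); last first.
    rewrite (relent_not_dominated nkla) addye//.
    by rewrite gt_eqF// (lt_le_trans _ (relent_ge0 _ _)).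
  have nlmu : ~ lambda `<< mu.
    by move=> lmu; apply: nkmu; exact: null_dominates_trans kla lmu.
  rewrite (relent_not_dominated nlmu) addey//.
  by rewrite gt_eqF// (lt_le_trans _ (relent_ge0 _ _)).
have [p pE] := exists_density kmu.
have [f fE] := exists_density (transports_dominates mumu kl kmu).
have [q qE] := exists_density (dominates_transports mumu kl ll kmu).
have law (phi : R -> R) : (forall t, 0 <= phi t)%R -> measurable_fun setT phi ->
    \int[kappa]_z (phi (f z))%:E = \int[lambda]_z (phi (f z))%:E.
  move=> phi0 mphi.
  apply: (@integral_invariant_density _ _ _ _ _ (EFin \o phi) mumu kl ll pE fE).
  - by move=> t; rewrite lee_fin.
  - exact/measurable_EFinP.
have := relent_chain qE fE.
rewrite (law _ (@lnneg_ge0 R) (@measurable_lnneg R)).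
rewrite (law _ (@lnpos_ge0 R) (@measurable_lnpos R)) -(klfun_integral fE).
rewrite -(relent_density fE) [RHS]addeA.
have fin : \int[lambda]_z (lnneg (f z))%:E \is a fin_num.
  rewrite ge0_fin_numE.
    by rewrite (le_lt_trans (integral_lnneg_le1 fE))// ltry.
  by apply: integral_ge0 => z _; rewrite lee_fin lnneg_ge0.
move=> h; rewrite -[LHS](addeK _ fin) h addeK//.
Qed.

End markov_density.

(** * From kernels to joint laws *)

Section weighted_measure.
Context d (T : measurableType d) (R : realType).
Variables (mu : {measure set T -> \bar R}) (f : T -> \bar R).

(** The hypotheses are arguments so that the measure structure below attaches to
    the applied constant. *)
Definition weighted (mf : measurable_fun setT f) (f0 : forall x, 0 <= f x)
  : set T -> \bar R := fun A => \int[mu]_(x in A) f x.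

Hypotheses (mf : measurable_fun setT f) (f0 : forall x, 0 <= f x).

Let weighted0 : weighted mf f0 set0 = 0. Proof. exact: integral_set0. Qed.

Let weighted_ge0 A : 0 <= weighted mf f0 A. Proof. exact: integral_ge0. Qed.

Let weighted_sigma_additive : semi_sigma_additive (weighted mf f0).
Proof.
move=> F mF tF mUF; rewrite /weighted ge0_integral_bigcup//; last first.
  exact: measurable_funTS.
by apply: is_cvg_nneseries => n _ _; exact: integral_ge0.
Qed.

HB.instance Definition _ := isMeasure.Build _ _ R
  (weighted mf f0) weighted0 weighted_ge0 weighted_sigma_additive.

End weighted_measure.

Definition countably_generated d (T : measurableType d) :=
  exists C : nat -> set T, @measurable d T = <<s range C >>.

(** Two finite measures of equal mass that agree on a generating pi-system are
    equal; countability lets almost sure equalities on its members hold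
    simultaneously. *)
Lemma countable_pi_system d (T : measurableType d) : countably_generated T ->
  exists C : nat -> set T, [/\ @measurable d T = <<s range C >>,
    setI_closed (range C) & range C setT].
Proof.
move=> [C mC].
(* Finite intersections of the generators, indexed by lists of indices. *)
pose E (s : seq nat) : set T := \big[setI/setT]_(i <- s) C i.
pose S n : seq nat := odflt [::] (unpickle n).
pose D n := E (S n).
have DE s : D (pickle s) = E s by rewrite /D /S pickleK.
have mE s : measurable (E s).
  rewrite /E; elim/big_ind : _ => // [A B mA mB|i _]; first exact: measurableI.
  by rewrite mC; apply: sub_sigma_algebra; exists i.
exists D; split.
- apply/seteqP; split => [A|].
    rewrite mC; apply: smallest_sub; first exact: smallest_sigma_algebra.
    move=> _ [i _ <-]; apply: sub_sigma_algebra; exists (pickle [:: i]) => //.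
    by rewrite DE /E big_seq1.
  apply: smallest_sub; first exact: sigma_algebra_measurable.
  by move=> _ [n _ <-]; exact: mE.
- move=> _ _ [i _ <-] [j _ <-].
  exists (pickle (S i ++ S j)) => //.
  by rewrite DE /E big_cat.
- by exists (pickle ([::] : seq nat)) => //; rewrite DE /E big_nil.
Qed.

Section kernel_density.
Context d1 d2 (T1 : measurableType d1) (T2 : measurableType d2) (R : realType).
Variables (mu : probability T1 R) (P M : R.-pker T1 ~> T2).

Lemma joint_setX (A : set T1) (B : set T2) : measurable A -> measurable B ->
  joint mu P (A `*` B) = \int[mu]_(x in A) P x B.
Proof.
move=> mA mB; rewrite jointE; last exact: measurableX.
rewrite [RHS]integral_mkcond; apply: eq_integral => x _.
rewrite patchE; case: ifPn => xA; first by rewrite in_xsectionX.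
by rewrite notin_xsectionX// measure0.
Qed.

Lemma integral_joint_setX (A : set T1) (B : set T2) (h : T1 * T2 -> \bar R) :
  measurable A -> measurable B ->
  (forall z, 0 <= h z) -> measurable_fun setT h ->
  \int[joint mu M]_(z in A `*` B) h z =
  \int[mu]_(x in A) \int[M x]_(y in B) h (x, y).
Proof.
move=> mA mB h0 mh; rewrite integral_mkcond integral_joint; last 2 first.
- by move=> z; exact: erestrict_ge0.
- apply/(measurable_restrictT _ _).1; first exact: measurableX.
  exact: measurable_funTS.
rewrite [RHS]integral_mkcond; apply: eq_integral => x _.
rewrite patchE; case: ifPn => xA.
  rewrite [RHS]integral_mkcond; apply: eq_integral => y _.
  by rewrite !patchE in_setX xA.
by apply: integral0_eq => y _; rewrite patchE in_setX (negbTE xA).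
Qed.

(** For each set [C n] of a countable generating pi-system, [P x (C n)] and the
    integral of [p (x, .)] over [C n] have the same integral in [x] over every
    measurable set, hence coincide for almost every [x]. For almost every [x]
    they coincide for all [n] at once, and then on all measurable sets. *)
Lemma kernel_density (p : T1 * T2 -> R) : countably_generated T2 ->
  is_density (joint mu P) (joint mu M) (EFin \o p) ->
  {ae mu, forall x, is_density (P x) (M x) (fun y => (p (x, y))%:E)}.
Proof.
move=> /countable_pi_system[C [mC IC TC]] pE.
have p0 z : 0 <= (p z)%:E by rewrite lee_fin (density_ge0 pE).
have mp : measurable_fun setT (EFin \o p) by case: pE.
have P1 x : P x setT = 1 by exact: prob_kernel.
have mCn n : measurable (C n) by rewrite mC; apply: sub_sigma_algebra; exists n.
have PC n : {ae mu, forall x, P x (C n) = \int[M x]_(y in C n) (p (x, y))%:E}.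
  suff : ae_eq mu setT (fun x => P x (C n))
      (fun x => \int[M x]_(y in C n) (p (x, y))%:E).
    by apply: filterS => x /(_ I).
  apply: integral_ae_eq => //.
  - apply/integrableP; split; first exact: measurable_kernel.
    apply: (@le_lt_trans _ _ (\int[mu]_x (cst 1 x))).
      apply: ge0_le_integral => //.
      + by apply: measurableT_comp => //; exact: measurable_kernel.
      + by move=> x _; rewrite gee0_abs//= -(P1 x) le_measure// inE.
    by rewrite integral_cst// mul1e (le_lt_trans (probability_le1 _ _))// ltry.
  - pose h := (EFin \o p) \_ (setT `*` C n).
    have -> : (fun x => \int[M x]_(y in C n) (p (x, y))%:E) =
        fun x => \int[M x]_y h (x, y).
      apply/funext => x; rewrite integral_mkcond; apply: eq_integral => y _.
      by rewrite /h !patchE in_setX in_setT.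
    apply: (measurable_fun_integral_finite_kernel h M).
      by move=> z; rewrite /h; apply: erestrict_ge0 => t _; exact: p0.
    apply/(measurable_restrictT _ _).1; first exact: measurableX.
    exact: measurable_funTS.
  - move=> E _ mE; rewrite -joint_setX//.
    transitivity (\int[joint mu M]_(z in E `*` C n) (EFin \o p) z).
      by case: pE => _ _ ->//; exact: measurableX.
    exact: (integral_joint_setX mE (mCn n) p0 mp).
apply: filterS (ae_foralln PC) => x PCx.
have mpx : measurable_fun setT (fun y => (p (x, y))%:E).
  exact: (measurableT_comp mp (pair1_measurable x)).
split => // A mA.
apply: (measure_unique (range C) (fun=> setT) mC IC _ _ (P x)
  (weighted (M x) mpx (fun y => p0 (x, y)))) => //.
- by rewrite bigcup_const.
- by move=> _ [n _ <-]; exact: PCx.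
- by move=> _; rewrite P1 ltry.
Qed.

Lemma joint_dominates :
  {ae mu, forall x, P x `<< M x} -> joint mu P `<< joint mu M.
Proof.
move=> PM; apply/null_content_dominatesP => A mA.
rewrite jointE// => MA0.
have mPA := measurable_fun_xsection_finite_kernel P (mem_set mA).
have mMA := measurable_fun_xsection_finite_kernel M (mem_set mA).
have M0 : ae_eq mu setT (fun x => M x (xsection A x)) (cst 0).
  apply/ae_eq_integral_abs => //.
  transitivity (\int[mu]_x M x (xsection A x)).
    by apply: eq_integral => x _; rewrite gee0_abs.
  exact: etrans (esym (jointE _ _ mA)) MA0.
rewrite (ae_eq_integral (cst 0))//; first by rewrite integral0.
apply: filterS2 PM M0 => x /null_content_dominatesP PMx /(_ I) Mx0 _.
by apply: PMx => //; exact: measurable_xsection.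
Qed.

End kernel_density.

(** The chain rule for relative entropy, for two joint laws with the same first
    marginal. *)
Lemma KL_joint d (T : measurableType d) (R : realType) (pi : probability T R)
    (P M : R.-pker T ~> T) : countably_generated T ->
  KL pi P M = relent (joint pi P) (joint pi M).
Proof.
move=> cgT; rewrite /KL; case: asboolP => [PM|nPM]; last first.
  rewrite relent_not_dominated// => /exists_density[p /(kernel_density cgT) pE].
  by apply: nPM; apply: filterS pE => x; exact: density_dominates.
have [p pE] := exists_density (joint_dominates PM).
have [N [mN N0 pN]] := filterI PM (kernel_density cgT pE).
have mk : measurable_fun setT (fun z => (klfun (p z))%:E).
  apply/measurable_EFinP; apply: measurableT_comp (measurable_density pE).
  exact: measurable_klfun.
rewrite (relent_density pE) integral_joint//; last first.
  by move=> z; rewrite lee_fin klfun_ge0// (density_ge0 pE).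
apply: (integral_eq_off_null mN) => // x Nx.
have [PMx pxE] : P x `<< M x /\ is_density (P x) (M x) (fun y => (p (x, y))%:E).
  by apply: contrapT => h; apply/Nx/pN.
rewrite -(@relent_density _ _ _ (kprob P x) (kprob M x) _ pxE).
by rewrite /relent asboolT.
Qed.

(** The balls with center in a countable dense set and radius [1 / n.+1] form a
    countable base. *)
Lemma polish_countably_generated (R : realType) (X : ptopologicalType) :
  polish R X -> countably_generated (borel X).
Proof.
move=> [dist [[dist0 distE distC distT] nbhsE _ [D [/pcard_injP[f finj] dD]]]].
pose B x (e : R) := [set y | (dist x y < e)%R].
have Bo x e : open (B x e).
  rewrite openE => y /= xy; apply/nbhsE; exists (e - dist x y)%R.
    by rewrite subr_gt0.
  move=> z /= yz; apply: le_lt_trans (distT x y z) _.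
  by rewrite addrC -ltrBrDr.
(* An enumeration of [D], inverse to the injection [f] into the naturals. *)
pose c n : X := xget point [set x | D x /\ f x = n].
have cf x : D x -> c (f x) = x.
  move=> Dx; apply: xget_unique => // y [Dy fyx].
  by apply: finj; rewrite ?inE.
pose C k : set X :=
  if (unpickle k : option (nat * nat)) is Some (i, n) then B (c i) n.+1%:R^-1%R
  else setT.
have Co k : open (C k) by rewrite /C; case: unpickle => [[]|]//; exact: openT.
exists C; apply/seteqP; split; last first.
  apply: smallest_sub; first exact: smallest_sigma_algebra.
  by move=> _ [k _ <-]; exact: sub_sigma_algebra.
apply: smallest_sub; first exact: smallest_sigma_algebra.
move=> U oU.
have -> : U = \bigcup_(k in [set k | C k `<=` U]) C k.
  apply/seteqP; split => [x Ux|x [k /= kU Ckx]]; last exact: kU.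
  have /nbhsE[e e0 xeU] : nbhs x U by exact: open_nbhs_nbhs.
  have [n] : exists n : nat, (0 + n.+1%:R^-1 < e / 2)%R.
    by apply: ltr_add_invr; rewrite divr_gt0.
  rewrite add0r => ne.
  have [y [/= xy Dy]] : B x n.+1%:R^-1%R `&` D !=set0.
    apply: dD; last exact: Bo.
    by exists x; rewrite /B/= (distE x x).2// invr_gt0.
  have CE : C (pickle (f y, n)) = B y n.+1%:R^-1%R by rewrite /C pickleK cf.
  exists (pickle (f y, n)); rewrite /= CE; last by rewrite /B/= distC.
  move=> z /= yz; apply: xeU; apply: le_lt_trans (distT x y z) _.
  by rewrite [e]splitr ltrD// (lt_trans _ ne).
apply: (@bigcup_measurable _ (g_sigma_algebraType (range C))) => k _.
by apply: sub_sigma_algebra; exists k.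
Qed.

(** * Data augmentation as a Markov kernel on pairs *)

Section random_map.
Context d1 d2 d3 (Z : measurableType d1) (W : measurableType d2)
  (Y : measurableType d3) (R : realType).
Variables (nu : probability W R) (T : Z * W -> Y).

(** The transition from [z] to [T (z, w)] with [w] drawn from [nu]. *)
Definition random_map (mT : measurable_fun setT T) :
    Z -> {measure set Y -> \bar R} :=
  mkcomp (kprobability (measurable_cst (nu : pprobability W R))) (kdirac mT).

Hypothesis mT : measurable_fun setT T.

Lemma random_mapE z A : random_map mT z A = \int[nu]_w (\1_A (T (z, w)))%:E.
Proof. by []. Qed.

Let measurable_random_map U :
  measurable U -> measurable_fun setT (random_map mT ^~ U).
Proof. by move=> mU; exact: measurable_fun_mkcomp_sfinite. Qed.

HB.instance Definition _ :=
  isKernel.Build _ _ Z Y R (random_map mT) measurable_random_map.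

Let random_map1 z : random_map mT z setT = 1.
Proof.
rewrite -(@probability_setT _ _ _ nu) -[RHS]mul1e -integral_cst//.
by apply: eq_integral => w _; rewrite /= diracT.
Qed.

HB.instance Definition _ :=
  Kernel_isProbability.Build _ _ Z Y R (random_map mT) random_map1.

End random_map.

Section augmentation.
Context (R : realType) (G : topologicalGroupType) d (X : measurableType d)
  (a : measurable_action G X) (pi : probability X R)
  (nu : probability (borel G * borel G)%type R).

(** The inverse comes from the change of variable [x = g^-1 x'] in
    [\int[pi]_x P (g x)], which is where the invariance of [pi] enters. *)
Definition twist (w : X * X * (borel G * borel G)) : X * X :=
  (a (w.2.1^-1)%g w.1.1, a w.2.2 w.1.2).

Lemma measurable_invg :
  measurable_fun setT (fun g : borel G => (g^-1)%g : borel G).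
Proof.
apply: (@measurability _ _ (borel G) (borel G) _ _ (@open G)) => // _ [U oU <-].
rewrite setTI; apply: sub_sigma_algebra; apply: open_comp => // g _.
exact: invg_continuous.
Qed.

Lemma measurable_act_comp d' (V : measurableType d') (g : V -> borel G)
    (x : V -> X) : measurable_fun setT g -> measurable_fun setT x ->
  measurable_fun setT (fun v => a (g v) (x v)).
Proof.
move=> mg mx; apply: (measurableT_comp (measurable_act a)
  (f := fun z : borel G * X => a z.1 z.2) (g := fun v => (g v, x v))).
exact/measurable_fun_pair.
Qed.

Lemma measurable_twist : measurable_fun setT twist.
Proof.
apply/measurable_fun_pair; apply: measurable_act_comp.
- apply: (measurableT_comp measurable_invg); exact: measurableT_comp.
- exact: measurableT_comp.
- exact: measurableT_comp.
- exact: measurableT_comp.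
Qed.

Lemma eq_joint (P Q : R.-pker X ~> X) A :
  (forall x B, measurable B -> P x B = Q x B) ->
  measurable A -> joint pi P A = joint pi Q A.
Proof.
move=> PQ mA; rewrite !jointE//; apply: eq_integral => x _.
by apply: PQ; exact: measurable_xsection.
Qed.

Lemma integral_invariant (inv_pi : invariant_measure a pi) (g : G)
    (h : X -> \bar R) : (forall x, 0 <= h x) -> measurable_fun setT h ->
  \int[pi]_x h (a g x) = \int[pi]_x h x.
Proof.
move=> h0 mh; have mag := measurable_actx a g.
transitivity (\int[pushforward pi (a g)]_x h x).
  by rewrite ge0_integral_pushforward.
apply: eq_measure_integral => A mA _.
transitivity (pi (a (g^-1)%g @` A)); last exact: inv_pi.
by rewrite act_image.
Qed.

(** Both sides are the [nu]-average over [(g, h)] of the mass that the joint law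
    of [P] gives to the pairs [(x, y)] with [(g^-1 x, h y)] in [A]. *)
Lemma twist_transports (inv_pi : invariant_measure a pi) (P : R.-pker X ~> X) :
  transports (random_map nu measurable_twist) (joint pi P)
    (joint pi (kda a nu P)).
Proof.
move=> A mA; rewrite [RHS]jointE//.
have mt (w : borel G * borel G) : measurable_fun setT (fun z => twist (z, w)).
  exact: (measurableT_comp measurable_twist (pair2_measurable w)).
pose phi (v : X * (borel G * borel G)) : \bar R :=
  P (a v.2.1 v.1) (a (v.2.2^-1)%g @` xsection A v.1).
have mphi : measurable_fun setT phi.
  pose k (w : X * (borel G * borel G) * X) : \bar R :=
    (\1_A (w.1.1, a w.1.2.2 w.2))%:E.
  have mk : measurable_fun setT k.
    apply/measurable_EFinP; apply: (measurableT_comp (measurable_indic mA)).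
    apply/measurable_fun_pair; first exact: measurableT_comp.
    apply: measurable_act_comp => //.
    by do 2 apply: measurableT_comp => //.
  have -> : phi = fun v => \int[kshift a P v]_y k (v, y).
    apply/funext => v; rewrite /phi act_image.
    have mS : measurable (a v.2.2 @^-1` xsection A v.1).
      rewrite -[X in measurable X]setTI; apply: measurable_actx => //.
      exact: measurable_xsection.
    transitivity (\int[P (a v.2.1 v.1)]_y
        (\1_(a v.2.2 @^-1` xsection A v.1) y)%:E).
      by rewrite integral_indic// setIT.
    by apply: eq_integral => y _; rewrite /k !indicE -mem_xsection.
  apply: measurable_fun_integral_finite_kernel => //.
  by move=> w; rewrite lee_fin.
transitivity (\int[joint pi P]_z \int[nu]_w (\1_A (twist (z, w)))%:E) => //.
have m1A : measurable_fun setT (fun v => (\1_A (twist v))%:E : \bar R).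
  apply/measurable_EFinP; apply: (measurableT_comp (measurable_indic mA)).
  exact: measurable_twist.
(* On both sides the average over [nu] becomes the outer integral. *)
rewrite (@fubini_tonelli _ _ _ _ _ (joint pi P) nu _ m1A)/=; last first.
  by move=> v; rewrite lee_fin.
rewrite (@fubini_tonelli _ _ _ _ _ pi nu _ mphi)/=; last first.
  by move=> v; exact: measure_ge0.
apply: eq_integral => w _.
pose Aw := (fun z => twist (z, w)) @^-1` A.
have mAw : measurable Aw by rewrite -[X in measurable X]setTI; exact: mt.
transitivity (joint pi P Aw).
  transitivity (\int[joint pi P]_z (\1_Aw z)%:E) => //.
  by rewrite integral_indic// setIT.
rewrite jointE// -(integral_invariant inv_pi w.1); last 2 first.
- by [].
- exact: (measurable_fun_xsection_finite_kernel P (mem_set mAw)).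
apply: eq_integral => x _; rewrite /phi/= act_image; congr (P _ _).
apply/seteqP; split => y; rewrite /xsection/= !inE /Aw /twist/=.
  by rewrite -actM mulVg act1.
by rewrite -actM mulVg act1.
Qed.

Lemma da_class_transports (inv_pi : invariant_measure a pi)
    (M : R.-pker X ~> X) :
  da_class a nu M ->
  transports (random_map nu measurable_twist) (joint pi M) (joint pi M).
Proof.
move=> daM A mA; rewrite (twist_transports inv_pi M mA).
by apply: eq_joint => // x B mB; exact: daM.
Qed.

Lemma KL_pythagoras (P M : R.-pker X ~> X) :
  countably_generated X -> invariant_measure a pi ->
  da_class a nu (kda a nu P) -> da_class a nu M ->
  KL pi P M = KL pi P (kda a nu P) + KL pi (kda a nu P) M.
Proof.
move=> cgX inv_pi daP daM; rewrite !KL_joint//.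
apply: (relent_pythagoras (K := random_map nu measurable_twist)).
- exact: da_class_transports.
- exact: twist_transports.
- exact: da_class_transports.
Qed.

Lemma KL_ge0 (P M : R.-pker X ~> X) : countably_generated X -> 0 <= KL pi P M.
Proof. by move=> cgX; rewrite KL_joint//; exact: relent_ge0. Qed.

Lemma da_class_kconst : invariant_measure a pi -> da_class a nu (kconst pi).
Proof.
move=> inv_pi x A mA.
transitivity (\int[nu]_gh (cst (pi A) gh)).
  by apply: eq_integral => gh _; exact: inv_pi.
by rewrite integral_cst// -[RHS]mule1; congr (_ * _); exact: probability_setT.
Qed.

End augmentation.

(** * The Pythagorean identity *)

Theorem theorem4p2 (R : realType)
    (G : topologicalGroupType) (lcG : locally_compact_group G)
    (mu : {measure set (borel G) -> \bar R}) (haar_mu : is_haar_measure mu)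
    (X : ptopologicalType) (polishX : polish R X)
    (a : measurable_action G (borel X))
    (pi : probability (borel X) R) (inv_pi : invariant_measure a pi)
    (m : {sigma_finite_measure set (borel X) -> \bar R})
    (density_pi : has_density pi m)
    (inv_m : forall g : G, is_density (pushforward m (a g)) m (cst 1))
    (P : R.-pker borel X ~> borel X)
    (density_P : forall x, has_density (P x) m)
    (nu : probability (borel G * borel G)%type R)
    (daP : da_class a nu (kda a nu P)) :
  (forall M : R.-pker borel X ~> borel X,
     (forall x, has_density (M x) m) -> da_class a nu M ->
     KL pi P M = KL pi P (kda a nu P) + KL pi (kda a nu P) M)
  /\ KL pi (kda a nu P) (kconst pi) <= KL pi P (kconst pi).
Proof.
have cgX := polish_countably_generated polishX.
split=> [M _ daM|]; first exact: KL_pythagoras.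
rewrite (KL_pythagoras cgX inv_pi daP (da_class_kconst nu inv_pi)).
by rewrite leeDr// KL_ge0.
Qed.
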